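(* Let $k\ge 1$ be an integer and let $x_1,\dots,x_k$ and $\omega_1,\dots,\omega_k$ be the nodes and weights of the $k$-point Gauss--Legendre quadrature rule on $[-1,1]$. For $z\in\mathbb{C}\setminus(-\infty,-1]$ set $$R_{k-1,k}(-z)=\sum_{i=1}^k\frac{\omega_i}{z(1+x_i)+2}.$$ Then $R_{k-1,k}(-z)$, as a rational function of $z$, is the $[k-1/k]$-Padé approximant (at $z=0$) of the function $\log(1+z)/z$, and it is given by $$R_{k-1,k}(-z)=\frac{\binom{2k}{k}\,P_{k-1,k}^{[1,2]}(-z)}{\binom{2k}{k}\;{}_2F_1(-k,-k;-2k;-z)},$$ where $$P_{k-1,k}^{[1,2]}(-z)=\sum_{j=0}^{k-1}\left(\sum_{\ell=0}^{j}\frac{(1)_{j-\ell}\,(-k)_\ell\,(-k)_\ell}{\ell!\,(-2k)_\ell\,(2)_{j-\ell}}\right)(-z)^j .$$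
   Context: $(q)_j$ is the Pochhammer symbol: $(q)_0=1$ and $(q)_j=q(q+1)\cdots(q+j-1)$ for $j\ge1$. The terminating Gauss hypergeometric function is the polynomial ${}_2F_1(-k,-k;-2k;-z)=\sum_{j=0}^{k}\frac{(-k)_j(-k)_j}{(-2k)_j}\frac{(-z)^j}{j!}$. $\log$ is the principal logarithm, and $\log(1+z)/z$ is taken to be $1$ at $z=0$; on $\mathbb{C}\setminus(-\infty,-1]$ one has $\frac{\log(1+z)}{z}=\int_{-1}^{1}\frac{dx}{z(1+x)+2}$, and $R_{k-1,k}(-z)$ is the Gauss--Legendre rule applied to this integral. The $k$-point Gauss--Legendre rule is the unique $k$-point quadrature rule $\int_{-1}^1 g(x)\,dx\approx\sum_{i=1}^k\omega_i g(x_i)$ exact for polynomials of degree at most $2k-1$; its nodes are the zeros of the Legendre polynomial of degree $k$. The $[m/k]$-Padé approximant of a function $f$ analytic at $0$ is the rational function $P/Q$ with $P,Q$ polynomials, $\deg P\le m$, $\deg Q\le k$, $Q(0)=1$, and $f(z)-P(z)/Q(z)=O(z^{m+k+1})$ as $z\to0$. *)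

(* Defs.v *)
From HB Require Import structures.
From mathcomp Require Import all_boot all_order all_algebra.
From mathcomp Require Import complex.
From mathcomp Require Import all_classical all_reals all_analysis.

Set Implicit Arguments.
Unset Strict Implicit.
Unset Printing Implicit Defensive.

Import Order.TTheory GRing.Theory Num.Theory.
Import numFieldNormedType.Exports.

#[global] Open Scope classical_set_scope.
#[global] Open Scope ring_scope.
#[global] Open Scope complex_scope.

Section Quadrature.
Variable R : realType.

(* The rule is only determined up to reindexing of the (node, weight) pairs.
   Degree at most 2k - 1 is [size p <= 2 * k]. *)
Definition gauss_legendre_rule (k : nat) (x w : 'I_k -> R) : Prop :=
  injective x /\
  forall p : {poly R}, (size p <= 2 * k)%N ->
    \int[@lebesgue_measure R]_(t in `[-1, 1]) p.[t] = \sum_(i < k) w i * p.[x i].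

End Quadrature.

Section ComplexFunctions.
Variable R : realType.
Implicit Types z q b c u : R[i].

(* Principal argument, with values in ]-pi, pi] for z != 0; the value at 0 is
   irrelevant. *)
Definition carg z : R :=
  let theta := acos (complex.Re z / Normc.normc z) in
  if 0 <= complex.Im z then theta else - theta.

Definition clog z : R[i] := ln (Normc.normc z) +i* carg z.

Definition log1p_quot z : R[i] := if z == 0 then 1 else clog (1 + z) / z.

Definition slit_plane : set R[i] :=
  ~` [set t%:C | t in [set t : R | t <= -1]].

Definition poch q (j : nat) : R[i] := \prod_(i < j) (q + i%:R).

(* 2F1(-n, b; c; u), the sum stopping at n because (-n)_j = 0 for j > n;
   meaningful when (c)_j != 0 for all j <= n, e.g. for b = -n, c = -2n. *)
Definition hyp2F1_term (n : nat) b c u : R[i] :=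
  \sum_(j < n.+1) poch (- n%:R) j * poch b j / poch c j * (u ^+ j / (j`!)%:R).

(* P^{[1,2]}_{k-1,k}(u) *)
Definition pade_num12 (k : nat) u : R[i] :=
  \sum_(j < k)
    (\sum_(l < j.+1)
        (poch 1 (j - l) * poch (- k%:R) l * poch (- k%:R) l) /
        ((l`!)%:R * poch (- (2 * k)%:R) l * poch 2 (j - l))) * u ^+ j.

(* P / Q is the [m/n]-Pade approximant of f at 0. *)
Definition pade_approximant (m n : nat) (f : R[i] -> R[i])
    (P Q : {poly R[i]}) : Prop :=
  [/\ (size P <= m.+1)%N, (size Q <= n.+1)%N, Q.[0] = 1 &
      (fun z : R[i]^o => (f z - P.[z] / Q.[z] : R[i]^o))
        =O_ (nbhs (0 : R[i]^o)) (fun z => (z ^+ (m + n).+1 : R[i]^o))].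

(* R_{k-1,k}(-z), for nodes x and weights w *)
Definition gauss_rat (k : nat) (x w : 'I_k -> R) z : R[i] :=
  \sum_(i < k) (w i)%:C / (z * (1 + (x i)%:C) + 2).

End ComplexFunctions.

(* Main.v *)
Require Import Defs.
From mathcomp Require Import all_boot all_order all_algebra.
From mathcomp Require Import complex polyrcf.
From mathcomp Require Import all_classical all_reals all_analysis.
From mathcomp Require Import ring lra zify.
Import Order.TTheory GRing.Theory Num.Theory.
Import numFieldNormedType.Exports.
Set Implicit Arguments.
Unset Strict Implicit.
Unset Printing Implicit Defensive.

(* Transport the rule to nodes s_i and weights v_i on [0, 1], so that
   R(-z) = sum_i v_i / (1 + z s_i).  Integrating by parts, the Rodrigues
   polynomial L = (X^k (X - 1)^k)^(k) / k! is orthogonal to lower degrees;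
   testing it against prod_(j != i) (X - s_j), whose square shows v_i > 0, gives
   L(s_i) = 0, hence L = C(2k, k) prod_i (X - s_i).  Reversing the coefficients
   of L yields the denominator Q(z) = prod_i (1 + z s_i) = 2F1(-k, -k; -2k; -z),
   and synthetic division of Q by the 1 + z s_i, summed with the moments
   sum_i v_i s_i^m = 1 / (m + 1), yields the numerator.  The same moments for
   m < 2k make R(-z) agree with log(1 + z) / z up to O(z^(2k)), and 0 <= s_i <= 1
   keeps the poles of R(-z) in the cut. *)

(** * Positivity and location of the nodes *)

(* The degree bound is on the antiderivative, one more than that of the
   integrand. *)
Definition unit_rule (R : realType) (k : nat) (s v : 'I_k -> R) : Prop :=
  injective s /\
  forall p : {poly R}, (size p <= (2 * k).+1)%N ->
    \sum_(i < k) v i * p^`().[s i] = p.[1] - p.[0].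

Lemma Rintegral_deriv_poly (R : realType) (a b : R) (p : {poly R}) : a < b ->
  \int[@lebesgue_measure R]_(t in `[a, b]) p^`().[t] = p.[b] - p.[a].
Proof.
move=> ab; rewrite /Rintegral (@continuous_FTC2 _ _ (horner p)) //.
- by apply: continuous_subspaceT => t; exact: continuous_horner.
- split.
  + by move=> t _; exact: derivable_horner.
  + by apply: cvg_at_right_filter; exact: continuous_horner.
  + by apply: cvg_at_left_filter; exact: continuous_horner.
- by move=> t _; rewrite -derive.derivE.
Qed.

Lemma unit_rule_of_gauss_legendre (R : realType) (k : nat) (x w : 'I_k -> R) :
  gauss_legendre_rule x w ->
  unit_rule (fun i => (1 + x i) / 2) (fun i => w i / 2).
Proof.
case=> xinj xwE; split=> [i j ij|p ps]; first by apply: xinj; lra.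
(* Pull [p] back along t -> (1 + t) / 2; the factor 1/2 from the chain rule becomes the halving of
   the weights. *)
pose q : {poly R} := p \Po (2^-1%:P * 'X + 2^-1%:P).
have qE t : q.[t] = p.[(1 + t) / 2].
  by rewrite /q horner_comp !hornerE; congr (p.[_]); field.
have q'E t : q^`().[t] = p^`().[(1 + t) / 2] / 2.
  rewrite /q deriv_comp !poly.derivE mul0r !hornerE horner_comp !hornerE.
  by congr (p^`().[_] * _); field.
have qs : (size q^`() <= 2 * k)%N.
  rewrite polyorder.size_deriv size_comp_poly2; first by case: (size p) ps.
  rewrite size_MXaddC polyC_eq0 invr_eq0 pnatr_eq0 /=.
  by rewrite size_polyC invr_eq0 pnatr_eq0.
have := xwE _ qs; rewrite Rintegral_deriv_poly; last lra.
rewrite !qE subrr mul0r (_ : (1 + 1) / 2 = 1) => [->|]; last by field.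
by apply: eq_bigr => i _; rewrite q'E; ring.
Qed.

Lemma poly_antideriv (R : numFieldType) (p : {poly R}) :
  exists2 q : {poly R}, q^`() = p & (size q <= (size p).+1)%N.
Proof.
(* At i = 0 this divides by zero, so the constant term is 0 by convention. *)
exists (\poly_(i < (size p).+1) (p`_i.-1 / i%:R)); last exact: size_poly.
apply/polyP => i; rewrite coef_deriv coef_poly ltnS.
case: ltnP => [_|pi]; last by rewrite mul0rn nth_default.
by rewrite /= -[LHS]mulr_natr divfK // pnatr_eq0.
Qed.

(* An antiderivative of p is nondecreasing on [0, 1]; were its values at 0 and 1
   equal, it would be constant there, forcing p = 0. *)
Lemma unit_rule_gt0 (R : realType) (k : nat) (s v : 'I_k -> R) (p : {poly R}) :
  unit_rule s v -> (size p <= 2 * k)%N -> p != 0 ->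
  (forall t, 0 <= t <= 1 -> 0 <= p.[t]) -> 0 < \sum_(i < k) v i * p.[s i].
Proof.
case=> _ svE ps p0 p_ge0; have [q q'p qs] := poly_antideriv p.
rewrite -q'p svE; last exact: leq_trans qs _.
have q_nd a b : 0 <= a -> a <= b -> b <= 1 -> q.[a] <= q.[b].
  move=> a0; rewrite le_eqVlt => /predU1P[->//|ab] b1.
  have [c /itvP cab] := poly_mvt q ab.
  rewrite q'p => qE; rewrite -subr_ge0 qE mulr_ge0 ?p_ge0 ?subr_ge0 ?(ltW ab)//.
  by rewrite (le_trans a0) ?cab//= (le_trans _ b1) ?cab.
rewrite subr_gt0 lt_neqAle q_nd // andbT; apply/negP => /eqP q01.
pose d := q - q.[0]%:P.
suff d0 : d = 0.
  move: p0; rewrite -q'p -[q](subrK q.[0]%:P) -/d.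
  by rewrite d0 add0r derivC eqxx.
apply/eqP; apply: contraTT isT => d0.
(* A nonzero [d] of size n has fewer than n roots, yet [d] vanishes at the n points i / (n + 1) of
   [0, 1]. *)
pose n := size d; pose f (i : nat) : R := i%:R / n.+1%:R.
have := @max_poly_roots _ d [seq f i | i <- iota 0 n] d0.
rewrite size_map size_iota ltnn => H; apply: H.
- apply/allP => t /mapP[l]; rewrite mem_iota /= => ltin ->.
  have f01 : 0 <= f l <= 1.
    by rewrite divr_ge0 ?ler0n//= ler_pdivrMr ?ltr0n// mul1r ler_nat; lia.
  case/andP: f01 => f0 f1.
  rewrite rootE /d !hornerE subr_eq0 eq_le; apply/andP; split; last exact: q_nd.
  by rewrite q01 q_nd.
- rewrite map_inj_uniq ?iota_uniq // => i j /(congr1 ( *%R^~ n.+1%:R)).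
  by rewrite /f !divfK ?pnatr_eq0// => /eqP; rewrite eqr_nat => /eqP.
Qed.

(** The Lagrange basis polynomial at s_i, left unnormalised. *)
Definition omit_poly (R : idomainType) (k : nat) (s : 'I_k -> R) (i : 'I_k) :
  {poly R} := \prod_(j < k | j != i) ('X - (s j)%:P).

Lemma horner_omit_poly (R : idomainType) (k : nat) (s : 'I_k -> R) (i j : 'I_k) :
  injective s -> ((omit_poly s i).[s j] != 0) = (i == j).
Proof.
move=> sinj; rewrite horner_prod; have [<-|ij] := eqVneq i j.
  by apply/prodf_neq0 => l li; rewrite !hornerE subr_eq0 inj_eq // eq_sym.
apply/negbTE/negPn/prodf_eq0; exists j; first by rewrite eq_sym.
by rewrite !hornerE subrr.
Qed.

Lemma size_omit_poly (R : idomainType) (k : nat) (s : 'I_k -> R) (i : 'I_k) :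
  size (omit_poly s i) = k.
Proof.
rewrite /omit_poly size_prod; last by move=> j _; rewrite polyXsubC_eq0.
under eq_bigr do rewrite size_XsubC.
rewrite sum_nat_const cardC1 card_ord; case: k s i => [|k] s i; first by case: i.
by rewrite /=; lia.
Qed.

Lemma sum_omit_poly (R : idomainType) (k : nat) (s v : 'I_k -> R) (p : {poly R})
    (i : 'I_k) : injective s ->
  \sum_(j < k) v j * (p * omit_poly s i).[s j] =
  v i * p.[s i] * (omit_poly s i).[s i].
Proof.
move=> sinj; rewrite (bigD1 i) //= big1 ?addr0 ?hornerM ?mulrA // => j ji.
rewrite hornerM; have := horner_omit_poly i j sinj.
by rewrite [i == j]eq_sym (negbTE ji) => /negbFE/eqP ->; rewrite !mulr0.
Qed.

Lemma unit_rule_weight_gt0 (R : realType) (k : nat) (s v : 'I_k -> R) i :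
  unit_rule s v -> 0 < v i.
Proof.
move=> sv; have [sinj _] := sv; have k0 : (0 < k)%N by case: i => m /=; lia.
have qs := size_omit_poly s i; have q0 : omit_poly s i != 0.
  by rewrite -size_poly_eq0 qs -lt0n.
have := @unit_rule_gt0 _ _ _ _ (omit_poly s i * omit_poly s i) sv.
rewrite size_mul // qs sum_omit_poly // -mulrA.
rewrite pmulr_lgt0; last by rewrite -expr2 exprn_even_gt0 //= horner_omit_poly.
apply.
- lia.
- by rewrite mulf_neq0.
- by move=> t _; rewrite hornerM -expr2 sqr_ge0.
Qed.

(* A node outside [0, 1] makes (X - s_i) prod_(j != i) (X - s_j)^2 of constant
   sign on [0, 1], while the rule integrates it to 0. *)
Lemma unit_rule_node (R : realType) (k : nat) (s v : 'I_k -> R) i :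
  unit_rule s v -> 0 <= s i <= 1.
Proof.
move=> sv; have [sinj _] := sv; have k0 : (0 < k)%N by case: i => m /=; lia.
have qs := size_omit_poly s i; have q0 : omit_poly s i != 0.
  by rewrite -size_poly_eq0 qs -lt0n.
(* [e] is the constant sign: 1 if s_i < 0, -1 if s_i > 1. The test polynomial has degree 2k - 1, the
   last one covered by exactness. *)
suff H (e : R) : e != 0 -> ~ forall t, 0 <= t <= 1 -> 0 <= e * (t - s i).
  apply/negPn/negP; rewrite negb_and -!ltNge => /orP[s0|s1].
    by apply: (H 1); rewrite ?oner_neq0 // => t; lra.
  by apply: (H (-1)); rewrite ?oppr_eq0 ?oner_neq0 // => t; lra.
move=> e0 sgn; pose p := e *: ('X - (s i)%:P).
have p0 : p != 0 by rewrite scaler_eq0 negb_or e0 polyXsubC_eq0.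
have psz : size p = 2%N by rewrite size_scale // size_XsubC.
have := @unit_rule_gt0 _ _ _ _ (p * omit_poly s i * omit_poly s i) sv.
rewrite size_mul ?mulf_neq0 // size_mul // qs sum_omit_poly // psz.
have pi : p.[s i] = 0 by rewrite /p !hornerE subrr mulr0.
rewrite hornerM pi !(mulr0, mul0r) ltxx => H; suff: false by []; apply: H.
- lia.
- by [].
- move=> t t01; rewrite -mulrA hornerM [X in _ * X]hornerM -expr2.
  by rewrite mulr_ge0 ?sqr_ge0 // /p !hornerE sgn.
Qed.

(** * Rodrigues' formula *)

Definition rodrigues_poly (R : nzRingType) (k : nat) : {poly R} :=
  'X^k * ('X - 1) ^+ k.

(** Each derivative lowers the multiplicity of a root by at most one. *)
Lemma derivn_XsubC_exp (R : comNzRingType) (c : R) (p : {poly R}) (n m : nat) :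
  exists r, (('X - c%:P) ^+ (n + m) * p)^`(m) = ('X - c%:P) ^+ n * r.
Proof.
elim: m n => [|m IH] n; first by exists p; rewrite addn0.
have [r] := IH n.+1; rewrite addSnnS => rE.
exists (r *+ n.+1 + ('X - c%:P) * r^`()).
by rewrite derivnS rE derivM deriv_exp derivXsubC /= exprS; ring.
Qed.

(** 0 and 1 are k-fold roots; this kills the boundary terms of the integrations by parts. *)
Lemma rodrigues_derivn_root (R : comNzRingType) (k m : nat) (c : R) : (m < k)%N ->
  c \in [:: 0; 1] -> ((rodrigues_poly R k)^`(m)).[c] = 0.
Proof.
move=> mk c01; have [p pE] : exists p,
    rodrigues_poly R k = ('X - c%:P) ^+ (k - m + m) * p.
  rewrite subnK 1?ltnW //; move: c01; rewrite !inE => /orP[]/eqP ->.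
    by exists (('X - 1) ^+ k); rewrite subr0.
  by exists 'X^k; rewrite mulrC.
have [r rE] := derivn_XsubC_exp c p (k - m) m.
rewrite pE rE -(prednK (n := k - m)) ?subn_gt0 //.
by rewrite exprS !hornerE subrr !mul0r.
Qed.

Lemma rodrigues_polyE (R : comNzRingType) (k : nat) : rodrigues_poly R k =
  \sum_(j < k.+1) ((-1) ^+ j * 'C(k, j)%:R) *: 'X^(2 * k - j).
Proof.
rewrite /rodrigues_poly exprDn mulr_sumr; apply: eq_bigr => j _.
have jk : (j <= k)%N by rewrite -ltnS.
have -> : (2 * k - j = k + (k - j))%N by lia.
by rewrite -mul_polyC rmorphM rmorphXn rmorphN1 rmorph_nat exprD -mulr_natr; ring.
Qed.

(* Legendre polynomial shifted to [0, 1]. *)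
Definition legendre_poly (R : nzRingType) (k : nat) : {poly R} :=
  (rodrigues_poly R k)^`N(k).

Lemma legendre_polyE (R : comNzRingType) (k : nat) : legendre_poly R k =
  \sum_(j < k.+1)
    ((-1) ^+ j * ('C(k, j) * 'C(2 * k - j, k))%:R) *: 'X^(k - j).
Proof.
rewrite /legendre_poly rodrigues_polyE raddf_sum; apply: eq_bigr => j _ /=.
rewrite nderivnZ nderivnXn -scaler_nat scalerA natrM mulrA.
by congr (_ *: 'X^_); have := ltn_ord j; lia.
Qed.

Lemma size_rodrigues_poly (R : idomainType) (k : nat) :
  size (rodrigues_poly R k) = (2 * k).+1.
Proof.
rewrite size_monicM ?monicXn //; last by rewrite expf_neq0 ?polyXsubC_eq0.
by rewrite size_polyXn size_exp_XsubC; lia.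
Qed.

Lemma coef_legendre_poly_max (R : comNzRingType) (k : nat) :
  (legendre_poly R k)`_k = 'C(2 * k, k)%:R.
Proof.
rewrite legendre_polyE coef_sum big_ord_recl /= big1 => [|j _].
  by rewrite coefZ coefXn !subn0 eqxx bin0 mul1n mulr1 expr0 mul1r addr0.
rewrite coefZ coefXn; case: eqP => [|_]; last by rewrite mulr0.
by rewrite /bump /=; case: j => j /=; lia.
Qed.

Lemma size_legendre_poly (R : numDomainType) (k : nat) :
  size (legendre_poly R k) = k.+1.
Proof.
apply/eqP; rewrite eqn_leq; apply/andP; split.
  apply/leq_sizeP => j kj; rewrite coef_nderivn nth_default ?mul0rn //.
  by rewrite size_rodrigues_poly; lia.
rewrite ltnNge; apply/negP => /leq_sizeP /(_ k (leqnn _)) /eqP.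
by rewrite coef_legendre_poly_max pnatr_eq0 eqn0Ngt bin_gt0; lia.
Qed.

(** Induction on m by parts: in (U^(m) q)' = U^(m+1) q + U^(m) q' the rule sends the left side to
    vanishing boundary values, and the last term falls under the induction hypothesis for q'. *)
Lemma unit_rule_orthogonal (R : realType) (k m : nat) (s v : 'I_k -> R)
    (q : {poly R}) : unit_rule s v -> (m <= k)%N -> (size q <= m)%N ->
  \sum_(i < k) v i * ((rodrigues_poly R k)^`(m) * q).[s i] = 0.
Proof.
move=> sv; elim: m q => [|m IH] q mk qm.
  move: qm; rewrite leqn0 size_poly_eq0 => /eqP ->.
  by apply: big1 => i _; rewrite mulr0 horner0 mulr0.
set U := rodrigues_poly R k in IH *.
have sU : (size U^`(m) <= 2 * k + 1 - m)%N.
  apply/leq_sizeP => j kj; rewrite coef_derivn nth_default ?mul0rn //.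
  by rewrite size_rodrigues_poly; lia.
(* The degrees 2k - m and m add up to exactly the bound of [unit_rule]. *)
have sUq : (size (U^`(m) * q)%R <= (2 * k).+1)%N.
  apply: leq_trans (size_polyMleq _ _) _; move: sU qm.
  by move: (size _) (size _) => a b; lia.
have := sv.2 _ sUq; rewrite !hornerM !rodrigues_derivn_root ?inE ?eqxx ?orbT //.
rewrite !mul0r subr0 derivM -derivnS.
under eq_bigr do rewrite hornerD mulrDr.
rewrite big_split /= IH ?addr0 ?(ltnW mk) //.
by rewrite polyorder.size_deriv; move: qm; case: (size q).
Qed.

Lemma unit_rule_legendre_root (R : realType) (k : nat) (s v : 'I_k -> R) i :
  unit_rule s v -> root (legendre_poly R k) (s i).
Proof.
move=> sv; have := @unit_rule_orthogonal _ _ k _ _ (omit_poly s i) sv.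
rewrite size_omit_poly leqnn => /(_ isT isT).
rewrite (sum_omit_poly _ _ _ sv.1) => /eqP.
rewrite !mulf_eq0 (negbTE (lt0r_neq0 (unit_rule_weight_gt0 i sv))) /=.
rewrite [X in _ || X](negbTE _) ?horner_omit_poly ?orbF //; last exact: sv.1.
by rewrite nderivn_def hornerMn mulrn_eq0 eqn0Ngt fact_gt0.
Qed.

Lemma unit_rule_legendreE (R : realType) (k : nat) (s v : 'I_k -> R) :
  unit_rule s v ->
  legendre_poly R k = 'C(2 * k, k)%:R *: \prod_(i < k) ('X - (s i)%:P).
Proof.
move=> sv; rewrite -coef_legendre_poly_max.
have -> : (legendre_poly R k)`_k = lead_coef (legendre_poly R k).
  by rewrite lead_coefE size_legendre_poly.
rewrite -(big_map s xpredT (fun a => 'X - a%:P)) /=.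
rewrite -[index_enum _]enumT; apply: all_roots_prod_XsubC.
- by rewrite size_map size_enum_ord size_legendre_poly.
- by apply/allP => _ /mapP[i _ ->]; exact: unit_rule_legendre_root sv.
- by rewrite uniq_rootsE map_inj_uniq ?enum_uniq //; exact: sv.1.
Qed.

(** * Denominator and numerator *)

(* Equals (-1)^l (-k)_l^2 / (l! (-2k)_l), see den_coef_poch; in this form it is
   a coefficient of legendre_poly. *)
Definition pade_den_coef (F : fieldType) (k l : nat) : F :=
  ('C(k, l) * 'C(2 * k - l, k))%:R / 'C(2 * k, k)%:R.

(** Coefficient of z^j in Q(z) log(1 + z) / z: the Cauchy product of the denominator with the series
    of coefficients (-1)^m / (m + 1). *)
Definition pade_num_coef (F : fieldType) (k j : nat) : F :=
  \sum_(l < j.+1) pade_den_coef F k l * ((-1) ^+ (j - l) / (j - l).+1%:R).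

Lemma unit_rule_moment (R : realType) (k m : nat) (s v : 'I_k -> R) :
  unit_rule s v -> (m < 2 * k)%N ->
  \sum_(i < k) v i * s i ^+ m = m.+1%:R^-1%R.
Proof.
move=> [_ svE] mk; have := svE 'X^(m.+1).
rewrite size_polyXn ltnS => /(_ mk).
rewrite !hornerXn expr1n expr0n subr0 derivXn /= => sE.
apply: (@mulIf _ m.+1%:R); first by rewrite pnatr_eq0.
rewrite mulVf ?pnatr_eq0 // -[RHS]sE mulr_suml; apply: eq_bigr => i _.

by rewrite hornerMn hornerXn -mulrA mulr_natr.
Qed.

(** This is L(s_i) = 0 up to the factor (-1)^k C(2k, k), in the shape of the remainder in
    [synthetic_division]. *)
Lemma unit_rule_den_root (R : realType) (k : nat) (s v : 'I_k -> R) i :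
  unit_rule s v ->
  \sum_(l < k.+1) pade_den_coef R k l * (- s i) ^+ (k - l) = 0.
Proof.
move=> sv; have /rootP := unit_rule_legendre_root i sv.
rewrite legendre_polyE horner_sum => sE.
apply: (@mulIf _ ((-1) ^+ k * 'C(2 * k, k)%:R)).
  by rewrite mulf_neq0 ?signr_eq0 // pnatr_eq0 -lt0n bin_gt0; lia.
rewrite mul0r -[RHS]sE mulr_suml; apply: eq_bigr => l _.
rewrite hornerZ hornerXn /pade_den_coef [(- s i) ^+ _]exprNn.
have -> : (-1) ^+ k = (-1) ^+ l * (-1) ^+ (k - l) :> R.
  by rewrite -exprD subnKC // -ltnS.
have : ((-1) ^+ (k - l)) ^+ 2 = 1 :> R by rewrite sqrr_sign.
have : 'C(2 * k, k)%:R != 0 :> R by rewrite pnatr_eq0 -lt0n bin_gt0; lia.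
move: ((-1) ^+ (k - l)) => e C0 e2; rewrite -[RHS]mul1r -[X in _ = X * _]e2.
field.
exact: C0.
Qed.

Lemma real_complex_sum (R : realType) (I : Type) (r : seq I) (P : pred I)
    (f : I -> R) :
  (\sum_(i <- r | P i) f i)%:C = \sum_(i <- r | P i) (f i)%:C.
Proof. by rewrite rmorph_sum. Qed.

Lemma real_complex_den_coef (R : realType) (k l : nat) :
  (pade_den_coef R k l)%:C = pade_den_coef R[i] k l.
Proof. by rewrite /pade_den_coef fmorph_div !rmorph_nat. Qed.

Lemma unit_rule_den_prod (R : realType) (k : nat) (s v : 'I_k -> R) (z : R[i]) :
  unit_rule s v ->
  \sum_(l < k.+1) pade_den_coef R[i] k l * z ^+ l =
  \prod_(i < k) (1 + z * (s i)%:C).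
Proof.
move=> sv; have C0 : 'C(2 * k, k)%:R != 0 :> R[i].
  by rewrite pnatr_eq0 -lt0n bin_gt0; lia.
(* The reversal evaluates L at -1/z, so z = 0 is treated apart; both sides are then 1. *)
have [->|z0] := eqVneq z 0.
  rewrite big_ord_recl /= !big1 ?addr0; last first.
  - by move=> i _; rewrite expr0n mulr0.
  - by move=> i _; rewrite mul0r addr0.
  by rewrite mulr1 /pade_den_coef bin0 mul1n subn0 divff.
have /(congr1 (map_poly (real_complex R))) := unit_rule_legendreE sv.
rewrite legendre_polyE map_polyZ rmorph_prod rmorph_sum /=.
move=> /(congr1 (fun p : {poly R[i]} => p.[- z^-1])).
rewrite hornerZ horner_prod horner_sum /= => /(congr1 ( *%R ((- z) ^+ k))).
rewrite rmorph_nat mulrCA => H; apply: (mulfI C0); transitivity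
   ('C(2 * k, k)%:R * ((- z) ^+ k *
     \prod_(i < k) (map_poly (real_complex R) ('X - (s i)%:P)).[- z^-1])).
  rewrite -H !mulr_sumr; apply: eq_bigr => l _.
  rewrite map_polyZ hornerZ map_polyXn hornerXn rmorphM rmorphXn rmorphN1 rmorph_nat.
  rewrite /pade_den_coef; set A := ('C(k, l) * _)%:R; set B := 'C(2 * k, k)%:R.
  have -> : (- z) ^+ k = (- z) ^+ l * (- z) ^+ (k - l).
    by rewrite -exprD subnKC // -ltnS.
  rewrite mulrA [B * _]mulrCA divff // mulr1.
  rewrite -invrN exprVn.
  have : (- z) ^+ (k - l) != 0 by rewrite expf_neq0 ?oppr_eq0.
  have : ((-1) ^+ l) ^+ 2 = 1 :> R[i] by rewrite sqrr_sign.
  rewrite [(- z) ^+ l]exprNn; move: ((- z) ^+ (k - l)) ((-1) ^+ l) => y e e2 y0.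
  by rewrite -[LHS]mul1r -[X in X * _ = _]e2; field.
(* Each of the k factors -z turns one -1/z - s_i into 1 + z s_i. *)
congr (_ * _); rewrite -[X in _ * X](_ : \prod_(i < k) (- z^-1 - (s i)%:C) = _).
  have -> : (- z) ^+ k = \prod_(i < k) (- z) by rewrite prodr_const card_ord.
  rewrite -big_split; apply: eq_bigr => i _.
  rewrite -[LHS]/(- z * (- z^-1 - (s i)%:C)).
  by rewrite mulrBr mulrNN mulfV // mulNr opprK.
by apply: eq_bigr => i _; rewrite map_polyXsubC !hornerE.
Qed.

(* The remainder term vanishes when - s^-1 is a root of the divided polynomial;
   this form also covers s = 0. *)
Lemma synthetic_division (R : comNzRingType) (d : nat -> R) (s z : R) (k : nat) :
  (1 + z * s) *
    \sum_(j < k) z ^+ j * \sum_(l < j.+1) d l * (- s) ^+ (j - l) =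
  \sum_(l < k.+1) d l * z ^+ l -
    z ^+ k * \sum_(l < k.+1) d l * (- s) ^+ (k - l).
Proof.
elim: k => [|k IH]; first by rewrite big_ord0 !big_ord1 !expr0 mul1r mulr0 subrr.
rewrite big_ord_recr /= mulrDr IH [in RHS]big_ord_recr /=.
rewrite [\sum_(l < k.+2) _ * (- s) ^+ _]big_ord_recr /= subnn expr0 mulr1.
have -> : \sum_(l < k.+1) d l * (- s) ^+ (k.+1 - l) =
    - s * \sum_(l < k.+1) d l * (- s) ^+ (k - l).
  rewrite mulr_sumr; apply: eq_bigr => l _.
  by rewrite subSn 1?leq_ord // exprS mulrCA.
rewrite exprS; ring.
Qed.

Lemma unit_rule_pade_num (R : realType) (k : nat) (s v : 'I_k -> R) (z : R[i]) :
  unit_rule s v -> (forall i, 1 + z * (s i)%:C != 0) ->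
  (\sum_(i < k) (v i)%:C / (1 + z * (s i)%:C)) *
    \sum_(l < k.+1) pade_den_coef R[i] k l * z ^+ l =
  \sum_(j < k) pade_num_coef R[i] k j * z ^+ j.
Proof.
move=> sv D0; rewrite mulr_suml.
(* Division of Q by each 1 + z s_i is exact, its remainder being zero by [unit_rule_den_root]. *)
transitivity (\sum_(i < k) (v i)%:C * \sum_(j < k) z ^+ j *
    \sum_(l < j.+1) pade_den_coef R[i] k l * (- (s i)%:C) ^+ (j - l)).
  apply: eq_bigr => i _; rewrite -mulrA; congr (_ * _).
  apply: (mulfI (D0 i)); rewrite synthetic_division mulVKf //.
  rewrite [X in _ - _ * X](_ : _ = 0) ?mulr0 ?subr0 //.
  rewrite -[RHS]/((0 : R)%:C) -(unit_rule_den_root i sv) real_complex_sum.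
  apply: eq_bigr => l _; rewrite -real_complex_den_coef.
  rewrite -(rmorphN (real_complex R)) -(rmorphXn (real_complex R)).
  by rewrite -(rmorphM (real_complex R)).
under eq_bigr do rewrite mulr_sumr.
rewrite exchange_big; apply: eq_bigr => j _ /=.
rewrite /pade_num_coef mulr_suml.
under eq_bigr do rewrite !mulr_sumr.
rewrite exchange_big; apply: eq_bigr => l _ /=.
(* Summing over the nodes now leaves the moment of order j - l, which is 1 / (j - l + 1). *)
have jl : (j - l < 2 * k)%N by have := ltn_ord j; lia.
have := congr1 (real_complex R) (unit_rule_moment sv jl).
rewrite fmorphV rmorph_nat => <-; rewrite rmorph_sum /= !mulr_sumr mulr_suml.
apply: eq_bigr => i _.
rewrite rmorphM rmorphXn /= [in LHS]exprNn; ring.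
Qed.

(** * Hypergeometric form *)

(** Integer form of C(2k - l, k) / C(2k, k) = (-k)_l / (-2k)_l, free of signs and divisions. *)
Lemma bin_central_ffact (k l : nat) : (l <= k)%N ->
  ('C(2 * k, k) * k ^_ l = 'C(2 * k - l, k) * (2 * k) ^_ l)%N.
Proof.
elim: l => [|l IH] lk; first by rewrite !ffactn0 subn0.
rewrite !ffactnSr !mulnA IH 1?ltnW //.
have := mul_bin_down (2 * k - l) k.
have -> : ((2 * k - l).-1 = 2 * k - l.+1)%N by lia.
have -> : (2 * k - l - k = k - l)%N by lia.
move: ('C(_, _)) ('C(_, _)) (_ ^_ _) => a b c; nia.
Qed.

Lemma poch_opp_nat (R : realType) (n j : nat) :
  poch (- n%:R : R[i]) j = (-1) ^+ j * (n ^_ j)%:R.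
Proof.
rewrite /poch; elim: j => [|j IH]; first by rewrite big_ord0 expr0 mul1r.
rewrite big_ord_recr /= {}IH exprS ffactnSr natrM.
(* For j > n the subtraction n - j is truncated, but n ^_ j is already zero. *)
have [jn|nj] := leqP j n; first by rewrite natrB //; ring.
by rewrite ffact_small // !(mul0r, mulr0).
Qed.

Lemma poch1 (R : realType) (j : nat) : poch (1 : R[i]) j = j`!%:R.
Proof.
rewrite /poch; elim: j => [|j IH]; first by rewrite big_ord0.
by rewrite big_ord_recr /= {}IH factS natrM -natr1; ring.
Qed.

Lemma poch2 (R : realType) (j : nat) : poch (2 : R[i]) j = (j.+1)`!%:R.
Proof.
rewrite /poch; elim: j => [|j IH]; first by rewrite big_ord0.
by rewrite big_ord_recr /= {}IH [in RHS]factS natrM -!natr1; ring.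
Qed.

(** Of the signs carried by the three Pochhammer symbols one (-1)^l survives; the powers of -z
    absorb it later. *)
Lemma den_coef_poch (R : realType) (k l : nat) : (l <= k)%N ->
  poch (- k%:R) l * poch (- k%:R) l / (l`!%:R * poch (- (2 * k)%:R) l) =
  (-1) ^+ l * pade_den_coef R[i] k l.
Proof.
move=> lk; rewrite !poch_opp_nat /pade_den_coef.
have C0 : 'C(2 * k, k)%:R != 0 :> R[i] by rewrite pnatr_eq0 -lt0n bin_gt0; lia.
have f0 : l`!%:R != 0 :> R[i] by rewrite pnatr_eq0 -lt0n fact_gt0.
have F0 : ((2 * k) ^_ l)%:R != 0 :> R[i] by rewrite pnatr_eq0 -lt0n ffact_gt0; lia.
have := congr1 (fun n : nat => n%:R : R[i]) (bin_central_ffact lk).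
have := congr1 (fun n : nat => n%:R : R[i]) (bin_ffact k l).
rewrite !natrM => <-; move: C0 f0 F0.
have : (-1) ^+ l != 0 :> R[i] by rewrite signr_eq0.
move: ('C(2 * k, k)%:R) ('C(2 * k - l, k)%:R) ((2 * k) ^_ l)%:R (l`!%:R)
  ('C(k, l)%:R) ((-1) ^+ l) => a b c d e s s0 a0 d0 c0 H.
apply: (mulfI a0); apply: (mulIf (mulf_neq0 d0 (mulf_neq0 s0 c0))).
rewrite -mulrA divfK ?mulf_neq0 //.
rewrite [RHS](_ : _ = s * s * d * e * (b * c)); last by field.
rewrite -H; ring.
Qed.

Lemma hyp2F1_den (R : realType) (k : nat) (z : R[i]) :
  hyp2F1_term k (- k%:R) (- (2 * k)%:R) (- z) =
  \sum_(l < k.+1) pade_den_coef R[i] k l * z ^+ l.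
Proof.
apply: eq_bigr => l _.
have := den_coef_poch R (_ : l <= k)%N; rewrite -ltnS => /(_ (ltn_ord l)).
move=> dE; apply: (mulfI (_ : (-1) ^+ l != 0)); first by rewrite signr_eq0.
rewrite [RHS]mulrA -dE [(- z) ^+ l]exprNn invfM.
have : ((-1) ^+ l) ^+ 2 = 1 :> R[i] by rewrite sqrr_sign.
move: ((-1) ^+ l) (poch _ _) ((poch _ _)^-1%R) (l`!%:R^-1%R) => e p q f e2.
rewrite -[RHS]mul1r -[X in _ = X * _]e2; ring.
Qed.

(** As (1)_m / (2)_m = 1 / (m + 1), the inner sum is the Cauchy product in [pade_num_coef], once
    (-1)^j is split as (-1)^l (-1)^(j - l). *)
Lemma pade_num12E (R : realType) (k : nat) (z : R[i]) :
  pade_num12 k (- z) = \sum_(j < k) pade_num_coef R[i] k j * z ^+ j.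
Proof.
apply: eq_bigr => j _; rewrite [(- z) ^+ j]exprNn mulrA; congr (_ * _).
rewrite mulr_suml; apply: eq_bigr => l _.
have lj : (l <= j)%N by rewrite -ltnS.
have := @den_coef_poch R k l (leq_trans lj (ltnW (ltn_ord j))).
rewrite poch1 poch2 !invfM => dE.
have : pade_den_coef R[i] k l = (-1) ^+ l * ((-1) ^+ l * pade_den_coef R[i] k l).
  by rewrite mulrA -expr2 sqrr_sign mul1r.
rewrite -dE => ->.
have -> : (-1) ^+ j = (-1) ^+ l * (-1) ^+ (j - l) :> R[i].
  by rewrite -exprD subnKC.
rewrite factS [((j - l).+1 * _)%:R]natrM invfM.
have f0 : (j - l)`!%:R != 0 :> R[i] by rewrite pnatr_eq0 -lt0n fact_gt0.
move: ((j - l)`!%:R) f0 => m m0.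
move: (poch _ _) ((poch _ _)^-1%R) (l`!%:R^-1%R) ((-1) ^+ l)
  ((-1) ^+ (j - l)) ((j - l).+1%:R^-1%R) => p q f e e' c.
have : (m * m^-1 = 1)%R by rewrite mulfV.
move: (m^-1%R) => m' mm.
rewrite -[RHS]mul1r -[X in _ = X * _]mm; ring.
Qed.

(** * Taylor expansion of the principal logarithm *)

Lemma normcX (R : rcfType) (z : R[i]) (n : nat) :
  Normc.normc (z ^+ n) = Normc.normc z ^+ n.
Proof.
elim: n => [|n IH]; first by rewrite expr0 Normc.normc1.
by rewrite exprS Normc.normcM IH exprS.
Qed.

Lemma normc_real (R : rcfType) (r : R) : 0 <= r -> Normc.normc r%:C = r.
Proof. by move=> r0; rewrite /Normc.normc /= expr0n addr0 sqrtr_sqr ger0_norm. Qed.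

Lemma Re_le_normc (R : rcfType) (z : R[i]) : `|complex.Re z| <= Normc.normc z.
Proof.
case: z => a b /=; rewrite -sqrtr_sqr ler_sqrt ?addr_ge0 ?sqr_ge0 //.
by rewrite lerDl sqr_ge0.
Qed.

Lemma Im_le_normc (R : rcfType) (z : R[i]) : `|complex.Im z| <= Normc.normc z.
Proof.
case: z => a b /=; rewrite -sqrtr_sqr ler_sqrt ?addr_ge0 ?sqr_ge0 //.
by rewrite lerDr sqr_ge0.
Qed.

Lemma normc_ge0 (R : rcfType) (z : R[i]) : 0 <= Normc.normc z.
Proof. by case: z => a b /=; rewrite sqrtr_ge0. Qed.

Lemma normc_le_ReIm (R : rcfType) (z : R[i]) :
  Normc.normc z <= `|complex.Re z| + `|complex.Im z|.
Proof.
case: z => a b /=; rewrite -[leRHS]ger0_norm ?addr_ge0 // -[leRHS]sqrtr_sqr.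
rewrite ler_sqrt ?sqr_ge0 // sqrrD !real_normK ?num_real // addrAC lerDl.
by rewrite mulrn_wge0 // mulr_ge0.
Qed.

Lemma normc_1Dge (R : rcfType) (z : R[i]) :
  1 - Normc.normc z <= Normc.normc (1 + z).
Proof.
have := @le_normcD R (1 + z) (- z).
by rewrite (addrK z (1 : R[i])) normcN Normc.normc1 -lerBlDr.
Qed.

(* Taylor polynomial of log (1 + z) / z rather than of log (1 + z). *)
Definition log1p_taylor (R : realType) (n : nat) (z : R[i]) : R[i] :=
  \sum_(m < n) (- z) ^+ m / m.+1%:R.

(* The mean value theorem fails for the complex path t |-> log (1 + t z), hence
   the real-linear functional phi (Re or Im). *)
Lemma log1p_taylor_component (R : realType) (phi : R[i] -> R) (f : R -> R)
    (z : R[i]) (n : nat) :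
  {morph phi : u v / u + v} -> (forall (r : R) u, phi (r%:C * u) = r * phi u) ->
  (forall u, `|phi u| <= Normc.normc u) ->
  Normc.normc z <= 2^-1%R -> f 0 = 0 ->
  (forall t : R, 0 <= t <= 1 -> is_derive t 1 f (phi (z / (1 + t%:C * z)))) ->
  `|f 1 - phi (z * log1p_taylor n z)| <= 2 * Normc.normc z ^+ n.+1.
Proof.
move=> phiD phiZ phi_le z2 f0 df.
have phi0 : phi 0 = 0.
  by rewrite -[X in phi X](mul0r 0) -[X in phi (X * _)]/((0 : R)%:C) phiZ mul0r.
have phi_sum (I : finType) (F : I -> R[i]) : phi (\sum_i F i) = \sum_i phi (F i).
  exact: big_morph.
have phiN u : phi (- u) = - phi u by apply/eqP; rewrite -addr_eq0 -phiD addNr phi0.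
(* z / (1 + t z) expands as the sum of the [c m] t^m; [p] integrates the image under [phi] of the
   first n terms. *)
pose c m := z * (- z) ^+ m.
pose p : {poly R} := \sum_(m < n) (phi (c m) / m.+1%:R) *: 'X^(m.+1).
have p0 : p.[0] = 0.
  by rewrite horner_sum big1 // => m _; rewrite hornerZ hornerXn expr0n mulr0.
have p1 : p.[1] = phi (z * log1p_taylor n z).
  rewrite horner_sum mulr_sumr phi_sum; apply: eq_bigr => m _.
  rewrite hornerZ hornerXn expr1n mulr1 mulrA -/(c m).
  have -> : c m / m.+1%:R = (m.+1%:R^-1%R : R)%:C * c m.
    by rewrite fmorphV rmorph_nat mulrC.
  by rewrite phiZ mulrC.
(* The inverse of this lower bound is the constant 2 of the statement. *)
have D0 (t : R) : 0 <= t <= 1 -> 2^-1%R <= Normc.normc (1 + t%:C * z).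
  case/andP=> t0 t1; apply: le_trans (normc_1Dge _).
  rewrite Normc.normcM normc_real //.
  have : t * Normc.normc z <= 1 * 2^-1%R by rewrite ler_pM // normc_ge0.
  lra.
have p' (t : R) : 0 <= t <= 1 -> p^`().[t] =
    phi (z / (1 + t%:C * z)) - phi (z * (- (t%:C * z)) ^+ n / (1 + t%:C * z)).
  move=> t01; have w0 : 1 + t%:C * z != 0.
    apply/eqP => /(congr1 (@Normc.normc R)); rewrite Normc.normc0 => w0.
    by have := D0 _ t01; rewrite w0 lt_geF.
  rewrite -phiN -phiD.
  have -> : z / (1 + t%:C * z) - z * (- (t%:C * z)) ^+ n / (1 + t%:C * z) =
     \sum_(m < n) (t ^+ m)%:C * c m.
    apply: (mulIf w0); rewrite mulrBl !divfK //.
    rewrite -[X in X - _]mulr1 -mulrBr -[X in X - _](expr1n _ n) subrXX opprK.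
    rewrite mulrCA [RHS]mulrC; congr (_ * _).
    rewrite mulr_sumr; apply: eq_bigr => m _.
    rewrite expr1n mul1r /c rmorphXn mulrCA -exprMn; congr (_ * _ ^+ _).
    by rewrite mulrN.
  rewrite phi_sum /p (raddf_sum (@deriv R)) /= horner_sum.
  apply: eq_bigr => m _.
  rewrite phiZ derivZ derivXn hornerZ hornerMn hornerXn.
  rewrite -[X in _ * X = _]mulr_natr mulrACA.
  by rewrite mulVf ?pnatr_eq0 // mulr1 mulrC.
(* The derivative of [g] is [phi] of a geometric remainder, so the real mean value theorem bounds
   g(1). *)
pose g : R -> R := f - horner p.
pose g' (t : R) := phi (z * (- (t%:C * z)) ^+ n / (1 + t%:C * z)).
have dg (t : R) : 0 <= t <= 1 -> is_derive t 1 g (g' t).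
  move=> t01; have := is_deriveB (df _ t01) (is_derive_poly p t).
  by rewrite (p' _ t01) opprB subrKC.
have dg_in (t : R) : t \in `]0, 1[ -> is_derive t 1 g (g' t).
  by rewrite in_itv /= => /andP[t0 t1]; apply: dg; rewrite !ltW.
have g_cont : {within `[0, 1], continuous g}.
  apply: derivable_within_continuous => t; rewrite in_itv /= => t01.
  by have [] := dg _ t01.
have [t] := MVT_segment ler01 dg_in g_cont.
rewrite in_itv /= => t01.
rewrite -[g 1]/(f 1 - p.[1]) -[g 0]/(f 0 - p.[0]) /g'.
rewrite f0 p0 p1 !subr0 mulr1 => ->; apply: le_trans (phi_le _) _.
rewrite !Normc.normcM Normc.normcV normcX normcN Normc.normcM.
case/andP: (t01) => t0 t1; rewrite (normc_real t0).
rewrite ler_pdivrMr; last by apply: lt_le_trans (D0 _ t01); rewrite invr_gt0.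
have z0 := normc_ge0 z; have d := D0 _ t01.
have tn : (t * Normc.normc z) ^+ n <= Normc.normc z ^+ n.
  by rewrite lerXn2r ?nnegrE ?mulr_ge0 // ler_piMl.
apply: le_trans (ler_wpM2l z0 tn) _; rewrite -exprS.
have : 0 <= Normc.normc z ^+ n.+1 by rewrite exprn_ge0.
move: (Normc.normc z ^+ n.+1) (Normc.normc _) d => y D d y0; nra.
Qed.

(** In the right half plane both components take forms that can be differentiated along the path 1 +
    t z. *)
Lemma clog_pos (R : realType) (x y : R) : 0 < x ->
  clog (x +i* y) = (2^-1%R * ln (x ^+ 2 + y ^+ 2)) +i* atan (y / x).
Proof.
move=> x0; have u0 : 0 < x ^+ 2 + y ^+ 2.
  by rewrite ltr_wpDr ?sqr_ge0 // exprn_gt0.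
congr (_ +i* _).
  rewrite /= -[in RHS](sqr_sqrtr (ltW u0)) lnXn ?sqrtr_gt0 //.
  lra.
(* [y'] stands for |y|, so one computation serves both branches of [carg]; oddness of the arctangent
   restores the sign. *)
have acosE (y' : R) : y' ^+ 2 = y ^+ 2 -> 0 <= y' ->
    acos (x / Num.sqrt (x ^+ 2 + y ^+ 2)) = atan (y' / x).
  move=> y2 y'0; have -> : x / Num.sqrt (x ^+ 2 + y ^+ 2) = cos (atan (y' / x)).
    rewrite cos_atan expr_div_n y2.
    have -> : 1 + y ^+ 2 / x ^+ 2 = (x ^+ 2 + y ^+ 2) / x ^+ 2.
      by field; rewrite gt_eqF.
    rewrite sqrtrM ?(ltW u0) // sqrtrV ?sqr_ge0 // sqrtr_sqr gtr0_norm //.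
    by rewrite invfM invrK mulrC.
  rewrite cosK // in_itv /=; apply/andP; split.
    by rewrite -(@atan0 R) le_atan // divr_ge0 // ltW.
  apply: ltW; apply: lt_le_trans (atan_ltpi2 _) _.
  by rewrite ler_pdivrMr // ler_peMr ?pi_ge0 // ler1n.
rewrite /carg /=; case: ifPn => y0; first exact: acosE.
rewrite (acosE (- y)) ?sqrrN ?mulNr ?atanN ?opprK //.
by rewrite oppr_ge0 ltW // ltNge.
Qed.

(** Real and imaginary parts each contribute a constant 2, since |w| <= |Re w| + |Im w|. *)
Lemma clog_taylor (R : realType) (n : nat) (z : R[i]) :
  Normc.normc z <= 2^-1%R ->
  Normc.normc (clog (1 + z) - z * log1p_taylor n z) <=
    4 * Normc.normc z ^+ n.+1.
Proof.
case: z => a b z2.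
(* |Re z| <= 1/2 keeps 1 + t z in the right half plane. Below, [pa] and [pb] are its real and
   imaginary parts and [u] its squared modulus. *)
have a2 (t : R) : 0 <= t <= 1 -> 0 < 1 + a * t.
  move=> /andP[t0 t1]; have := le_trans (Re_le_normc (a +i* b)) z2.
  rewrite /= ler_norml => /andP[]; nra.
pose pa : {poly R} := a *: 'X + 1; pose pb : {poly R} := b *: 'X.
pose u : {poly R} := pa ^+ 2 + pb ^+ 2.
have paE t : pa.[t] = 1 + a * t by rewrite /pa !hornerE addrC.
have pbE t : pb.[t] = b * t by rewrite /pb !hornerE.
have uE t : u.[t] = (1 + a * t) ^+ 2 + (b * t) ^+ 2.
  by rewrite /u hornerD !horner_exp paE pbE.
have pa'E t : pa^`().[t] = a by rewrite /pa !poly.derivE !hornerE.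
have pb'E t : pb^`().[t] = b by rewrite /pb !poly.derivE !hornerE.
have u'E t : u^`().[t] = 2 * (a * (1 + a * t) + b * (b * t)).
  rewrite /u derivD !deriv_exp /= !expr1 hornerD !hornerMn !hornerM paE pbE pa'E pb'E.
  ring.
have quotE (t : R) : 1 + t%:C * (a +i* b) = (1 + a * t) +i* (b * t).
  by congr (_ +i* _); rewrite /=; ring.
have u0 (t : R) : 0 <= t <= 1 -> 0 < u.[t].
  by move=> /a2 at0; rewrite uE ltr_wpDr ?sqr_ge0 // exprn_gt0.
have ReE := @log1p_taylor_component R (@complex.Re R)
  (fun t => 2^-1%R * ln u.[t]) (a +i* b) n.
have ImE := @log1p_taylor_component R (@complex.Im R)
  (fun t => atan (pb.[t] / pa.[t])) (a +i* b) n.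
have clogE : clog (1 + (a +i* b)) = (2^-1%R * ln u.[1]) +i* atan (pb.[1] / pa.[1]).
  have -> : 1 + (a +i* b) = (1 + a) +i* b by congr (_ +i* _); rewrite /= add0r.
  rewrite clog_pos ?uE ?pbE ?paE ?mulr1 //.
  by have := a2 1; rewrite mulr1 ler01 lexx; apply.
apply: le_trans (normc_le_ReIm _) _; rewrite clogE.
have -> (y : R) : 4 * y = 2 * y + 2 * y by ring.
apply: lerD.
  rewrite raddfB; apply: ReE => //.
  - by case=> ? ? [].
  - by move=> r [? ?] /=; rewrite mul0r subr0.
  - exact: Re_le_normc.
  - by rewrite uE !mulr0 addr0 expr1n expr0n addr0 ln1 mulr0.
  - move=> t t01; have t0 := u0 _ t01.
    have D := is_deriveZ (2^-1%R)
      (is_derive1_comp (is_derive1_ln t0) (is_derive_poly u t)).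
    apply: (is_derive_eq D); move: t0; rewrite u'E uE quotE /= => /lt0r_neq0 t0.
    by rewrite /GRing.scale /=; field.
rewrite raddfB; apply: ImE => //.
- by case=> ? ? [].
- by move=> r [? ?] /=; rewrite mul0r addr0.
- exact: Im_le_normc.
- by rewrite pbE mulr0 mul0r atan0.
- move=> t t01; have at0 := lt0r_neq0 (a2 _ t01); have t0 := lt0r_neq0 (u0 _ t01).
  have pa0 : pa.[t] != 0 by rewrite paE.
  pose q (r : R) := pb.[r] / pa.[r].
  have Dq : is_derive t 1 q _ :=
    is_deriveM (is_derive_poly pb t) (is_deriveV pa0 (is_derive_poly pa t)).
  apply: (is_derive_eq (@is_derive1_comp _ _ q _ _ _ (is_derive1_atan (q t)) Dq)).
  move: t0; rewrite /q pa'E pb'E uE pbE paE quotE /= => t0.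
  rewrite /GRing.scale /=.
  by field; rewrite t0 at0.
Qed.

(** * Approximation order *)

Lemma normc_mul_le (R : realType) (s : R) (z : R[i]) :
  0 <= s <= 1 -> Normc.normc (z * s%:C) <= Normc.normc z.
Proof.
by move=> /andP[s0 s1]; rewrite Normc.normcM normc_real // ler_piMr ?normc_ge0.
Qed.

Lemma normc_1Dmul_ge (R : realType) (s : R) (z : R[i]) :
  0 <= s <= 1 -> Normc.normc z <= 2^-1%R ->
  2^-1%R <= Normc.normc (1 + z * s%:C).
Proof.
move=> s01 z2; apply: le_trans (normc_1Dge _).
by have := normc_mul_le z s01; lra.
Qed.

Lemma normc_1Dmul_neq0 (R : realType) (s : R) (z : R[i]) :
  0 <= s <= 1 -> Normc.normc z <= 2^-1%R -> 1 + z * s%:C != 0.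
Proof.
move=> s01 z2; apply/eqP => D0; have := normc_1Dmul_ge s01 z2.
by rewrite D0 Normc.normc0; lra.
Qed.

(** With u = z s the difference is -(-u)^n / (1 + u), where |u| <= |z| and |1 + u| >= 1/2. *)
Lemma geometric_error (R : realType) (n : nat) (s : R) (z : R[i]) :
  0 <= s <= 1 -> Normc.normc z <= 2^-1%R ->
  Normc.normc (\sum_(m < n) (- z * s%:C) ^+ m - (1 + z * s%:C)^-1) <=
    2 * Normc.normc z ^+ n.
Proof.
move=> s01 z2; have D2 := normc_1Dmul_ge s01 z2.
have D0 := normc_1Dmul_neq0 s01 z2; have zs := normc_mul_le z s01.
have z0 := normc_ge0 z.
rewrite mulNr; set u := z * s%:C in zs D2 D0 *.
have E : (\sum_(m < n) (- u) ^+ m) * (1 + u) = 1 - (- u) ^+ n.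
  rewrite -[X in X - _](expr1n _ n) subrXX opprK mulrC; congr (_ * _).
  by apply: eq_bigr => m _; rewrite expr1n mul1r.
have -> : \sum_(m < n) (- u) ^+ m - (1 + u)^-1%R = - ((- u) ^+ n / (1 + u)).
  by apply: (mulIf D0); rewrite mulrBl mulVf // E addrAC subrr add0r mulNr divfK.
rewrite normcN Normc.normcM Normc.normcV normcX normcN.
rewrite ler_pdivrMr; last by apply: lt_le_trans D2; rewrite invr_gt0.
have : Normc.normc u ^+ n <= Normc.normc z ^+ n.
  by rewrite lerXn2r ?nnegrE ?normc_ge0.
have : 0 <= Normc.normc z ^+ n by rewrite exprn_ge0.
move: (_ ^+ n) (_ ^+ n) (Normc.normc _) D2 => a b d; nra.
Qed.

Lemma normc_sum (R : rcfType) (I : finType) (F : I -> R[i]) :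
  Normc.normc (\sum_i F i) <= \sum_i Normc.normc (F i).
Proof.
elim/big_rec2: _ => [|i y1 y2 _ IH]; first by rewrite Normc.normc0.
by rewrite (le_trans (le_normcD _ _)) // lerD2l.
Qed.

(** Both sides are compared with the Taylor polynomial of 2k terms: the logarithm costs 4, the rule
    2. *)
Lemma unit_rule_log1p_error (R : realType) (k : nat) (s v : 'I_k -> R)
    (z : R[i]) : unit_rule s v -> (0 < k)%N -> Normc.normc z <= 2^-1%R ->
  Normc.normc (log1p_quot z - \sum_(i < k) (v i)%:C / (1 + z * (s i)%:C)) <=
    6 * Normc.normc z ^+ (2 * k).
Proof.
move=> sv k0 z2; set n := (2 * k)%N.
have lE : Normc.normc (log1p_quot z - log1p_taylor n z) <= 4 * Normc.normc z ^+ n.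
  rewrite /log1p_quot; case: eqVneq => [->|z0].
    have -> : log1p_taylor n (0 : R[i]) = 1.
      rewrite /log1p_taylor oppr0 /n -(prednK k0) mulnS add2n.
      rewrite big_ord_recl big1 => [|m _].
        by rewrite expr0 divr1 addr0.
      by rewrite expr0n mul0r.
    by rewrite subrr Normc.normc0 mulr_ge0 ?exprn_ge0.
  have nz0 : 0 < Normc.normc z.
    rewrite lt_neqAle normc_ge0 andbT eq_sym.
    by apply: contra z0 => /eqP/Normc.eq0_normc ->.
  rewrite -(ler_pM2l nz0) -Normc.normcM mulrBr [z * (_ / z)]mulrC divfK //.
  by rewrite mulrCA -exprS clog_taylor.
have gE : Normc.normc (log1p_taylor n z - \sum_(i < k) (v i)%:C / (1 + z * (s i)%:C))
    <= 2 * Normc.normc z ^+ n.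
  (* Exact moments below 2k make the Taylor polynomial the rule applied to the truncated geometric
     series. *)
  have -> : log1p_taylor n z =
      \sum_(i < k) (v i)%:C * \sum_(m < n) (- z * (s i)%:C) ^+ m.
    under [RHS]eq_bigr do rewrite mulr_sumr.
    rewrite exchange_big; apply: eq_bigr => m _ /=.
    have := congr1 (real_complex R) (unit_rule_moment sv (ltn_ord m)).
    rewrite fmorphV rmorph_nat => <-; rewrite rmorph_sum mulr_sumr.
    by apply: eq_bigr => i _ /=; rewrite rmorphM rmorphXn exprMn mulrCA.
  rewrite -sumrB; apply: le_trans (normc_sum _) _.
  (* Positive weights of sum 1 average the geometric errors without enlarging the constant. *)
  have v1 : \sum_(i < k) v i = 1.
    have := @unit_rule_moment _ _ 0 _ _ sv; rewrite muln_gt0 k0 invr1 => <- //.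
    by apply: eq_bigr => i _; rewrite expr0 mulr1.
  rewrite -[leRHS]mul1r -[X in _ <= X * _]v1 mulr_suml; apply: ler_sum => i _.
  have vi := ltW (unit_rule_weight_gt0 i sv).
  rewrite -mulrBr Normc.normcM normc_real //; apply: ler_wpM2l => //.
  exact: geometric_error (unit_rule_node i sv) z2.
rewrite -[_ - \sum_i _](subrKA (log1p_taylor n z)).
apply: le_trans (le_normcD _ _) _; lra.
Qed.

(** * Poles on the cut, and conclusion *)

(** A zero would give z = -1/s with 0 < s <= 1, a point of the cut. *)
Lemma slit_plane_node (R : realType) (s : R) (z : R[i]) :
  0 <= s <= 1 -> slit_plane z -> 1 + z * s%:C != 0.
Proof.
move=> /andP[s0 s1] zslit; apply/eqP => zs; apply: zslit.
have s0' : s != 0.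
  by apply: contra_eqN zs => /eqP ->; rewrite mulr0 addr0 oner_eq0.
exists (- s^-1%R); first by rewrite /= lerN2 invf_ge1 // lt_neqAle eq_sym s0'.
have sC : s%:C != 0 by rewrite fmorph_eq0.
apply: (mulIf sC); rewrite rmorphN fmorphV mulNr mulVf //.

by apply/eqP; rewrite eq_sym -addr_eq0 addrC zs eqxx.
Qed.

Lemma gauss_ratE (R : realType) (k : nat) (x w : 'I_k -> R) (z : R[i]) :
  gauss_rat x w z =
  \sum_(i < k) (w i / 2)%:C / (1 + z * ((1 + x i) / 2)%:C).
Proof.
apply: eq_bigr => i _; rewrite !rmorphM fmorphV rmorph_nat rmorphD rmorph1 /=.
have -> : z * (1 + (x i)%:C) + 2 = 2 * (1 + z * ((1 + (x i)%:C) / 2)).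
  by field.
by rewrite invfM [LHS]mulrA.
Qed.

Theorem proposition3p1 (R : realType) (k : nat) (x w : 'I_k -> R) :
  (1 <= k)%N ->
  gauss_legendre_rule x w ->
  (exists P Q : {poly R[i]},
     pade_approximant k.-1 k (@log1p_quot R) P Q /\
     forall z : R[i], slit_plane z ->
       [/\ forall i : 'I_k, z * (1 + (x i)%:C) + 2 != 0,
           Q.[z] != 0 &
           gauss_rat x w z = P.[z] / Q.[z]]) /\
  (forall z : R[i], slit_plane z ->
     let F := hyp2F1_term k (- k%:R) (- (2 * k)%:R) (- z) in
     F != 0 /\
     gauss_rat x w z =
       ('C(2 * k, k)%:R * pade_num12 k (- z)) / ('C(2 * k, k)%:R * F)).
Proof.
move=> k0 xw; have sv := unit_rule_of_gauss_legendre xw.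
pose P : {poly R[i]} := \poly_(j < k) pade_num_coef R[i] k j.
pose Q : {poly R[i]} := \poly_(l < k.+1) pade_den_coef R[i] k l.
have PE z : P.[z] = pade_num12 k (- z) by rewrite horner_poly pade_num12E.
have QE z : Q.[z] = hyp2F1_term k (- k%:R) (- (2 * k)%:R) (- z).
  by rewrite horner_poly hyp2F1_den.
(* Assuming only nonzero factors lets this serve both the slit plane and the disc |z| <= 1/2. *)
have QP z : (forall i, 1 + z * ((1 + x i) / 2)%:C != 0) ->
    Q.[z] != 0 /\ gauss_rat x w z = P.[z] / Q.[z].
  move=> D0; have Q0 : Q.[z] != 0.
    by rewrite horner_poly (unit_rule_den_prod z sv); apply/prodf_neq0 => i _.
  split=> //; apply: (mulIf Q0); rewrite divfK // gauss_ratE !horner_poly.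
  exact: unit_rule_pade_num sv D0.
have slit z : slit_plane z -> forall i, 1 + z * ((1 + x i) / 2)%:C != 0.
  by move=> zslit i; apply: slit_plane_node zslit; exact: unit_rule_node sv.
split; last first.
  move=> z /slit/QP[]; rewrite PE QE => F0 ->; split=> //.
  by rewrite -mulf_div divff ?mul1r // pnatr_eq0 -lt0n bin_gt0; lia.
exists P, Q; split; last first.
  move=> z zslit; have [Q0 E] := QP z (slit z zslit); split=> // i.
  have -> : z * (1 + (x i)%:C) + 2 = 2 * (1 + z * ((1 + x i) / 2)%:C).
    by rewrite rmorphM fmorphV rmorph_nat rmorphD rmorph1; field.
  by rewrite mulf_neq0 ?pnatr_eq0 // slit.
split; rewrite ?size_poly //.
- by rewrite prednK // size_poly.
- rewrite horner_coef0 coef_poly /pade_den_coef bin0 mul1n subn0 divff //.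
  by rewrite pnatr_eq0 -lt0n bin_gt0; lia.
(* The constant of [unit_rule_log1p_error], valid on the disc |z| <= 1/2. *)
apply/eqO_exP; exists 6; first by rewrite ltr0n.
have -> : (k.-1 + k).+1 = (2 * k)%N by lia.
have := @nbhs0_le _ (R[i]^o) (2^-1%R)%:C.
rewrite -(rmorph0 (real_complex R)) ltcR invr_gt0 ltr0n => /(_ isT).
apply: filterS => z.
rewrite -[`|z|]/((Normc.normc z)%:C) lecR => z2.
have D0 i : 1 + z * ((1 + x i) / 2)%:C != 0.
  exact: normc_1Dmul_neq0 (unit_rule_node i sv) z2.
have [_ <-] := QP z D0; rewrite gauss_ratE.
by have := unit_rule_log1p_error sv k0 z2; rewrite -lecR rmorphM rmorph_nat -normcX.
Qed.
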